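(* The set $\Gamma_{E(3;3;1,1,1)}\subset\mathbb C^7$ is simply connected.
   Context: For a linear subspace $E$ of $\mathcal M_{n\times n}(\mathbb C)$, $\mu_E(A)=1/\inf\{\|X\|: X\in E,\ \det(I-AX)=0\}$, with $\mu_E(A)=0$ if $I-AX$ is nonsingular for all $X\in E$ (operator norm). $E(3;3;1,1,1)$ is the space of $3\times 3$ diagonal matrices, and $\Gamma_{E(3;3;1,1,1)}=\{\pi(A): A\in\mathcal M_{3\times3}(\mathbb C),\ \mu_{E(3;3;1,1,1)}(A)\le1\}$ where $$\pi(A)=\big(a_{11},\ a_{22},\ a_{11}a_{22}-a_{12}a_{21},\ a_{33},\ a_{11}a_{33}-a_{13}a_{31},\ a_{22}a_{33}-a_{23}a_{32},\ \det A\big).$$ *)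

(* Defs.v *)
From HB Require Import structures.
From mathcomp Require Import all_boot all_order all_algebra.
From mathcomp Require Import all_classical all_reals all_analysis.
From mathcomp Require Import complex.

Set Implicit Arguments.
Unset Strict Implicit.
Unset Printing Implicit Defensive.

Import Order.TTheory GRing.Theory Num.Theory.
Import numFieldNormedType.Exports.

Local Open Scope classical_set_scope.
Local Open Scope ring_scope.
Local Open Scope complex_scope.

(* A subset A of a topological space, with the induced topology. Paths and
   homotopies are total functions on R or R * R that are only constrained on
   [0, 1] or its square. *)
Definition is_path (R : realType) (T : topologicalType) (A : set T)
    (x y : T) (f : R -> T) : Prop :=
  [/\ {within `[0, 1]%classic, continuous f},
      f @` `[0, 1]%classic `<=` A, f 0 = x & f 1 = y].

Definition path_connected (R : realType) (T : topologicalType) (A : set T) :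
    Prop :=
  A !=set0 /\
  forall x y, A x -> A y -> exists f : R -> T, is_path A x y f.

(* H (s, t): s is the homotopy parameter, t the loop parameter; the base
   point is kept fixed throughout. *)
Definition null_homotopic (R : realType) (T : topologicalType) (A : set T)
    (x : T) (f : R -> T) : Prop :=
  exists H : R * R -> T,
    [/\ {within `[0, 1]%classic `*` `[0, 1]%classic, continuous H},
        H @` (`[0, 1]%classic `*` `[0, 1]%classic) `<=` A,
        forall t, t \in `[0, 1] -> H (0, t) = f t,
        forall t, t \in `[0, 1] -> H (1, t) = x &
        forall s, s \in `[0, 1] -> H (s, 0) = x /\ H (s, 1) = x].

Definition simply_connected (R : realType) (T : topologicalType)
    (A : set T) : Prop :=
  path_connected R A /\
  forall (x : T) (f : R -> T), A x -> is_path A x x f -> null_homotopic A x f.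

(* Real-valued Euclidean norm on C^n; the library's norm on matrices is the
   max norm. *)
Definition enorm (R : realType) (n : nat) (v : 'cV[R[i]]_n) : R :=
  Num.sqrt (\sum_(k < n) ComplexField.Normc.normc (v k 0) ^+ 2).

Definition opnorm (R : realType) (n : nat) (X : 'M[R[i]]_n) : R :=
  sup [set enorm (X *m v) | v in [set v | enorm v <= 1]].

Section StructuredSingularValue.
Variables (R : realType) (n : nat).
Implicit Types (E : {vspace 'M[R[i]]_n}) (A X : 'M[R[i]]_n).

Definition singularizing E A : set 'M[R[i]]_n :=
  [set X | X \in E /\ \det (1%:M - A *m X) = 0].

Definition mu E A : R :=
  if `[< singularizing E A = set0 >] then 0
  else 1 / inf [set opnorm X | X in singularizing E A].

End StructuredSingularValue.

Definition E33111 (R : realType) : {vspace 'M[R[i]]_3} :=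
  limg (linfun (@diag_mx R[i] 3)).

Lemma mem_E33111 (R : realType) (X : 'M[R[i]]_3) :
  (X \in E33111 R) = is_diag_mx X.
Proof.
apply/memv_imgP/is_diag_mxP => [[d _ ->] i j neq_ij|diagX].
  by rewrite lfunE mxE -val_eqE (negPf neq_ij) mulr0n.
exists (\row_i X i i); rewrite ?memvf// lfunE; apply/matrixP => i j.
by rewrite !mxE; case: eqVneq => [->//|]; rewrite -val_eqE => /diagX.
Qed.

(* R[i]^o is R[i] with the topology of its norm, so the codomain is C^7 with
   the product topology. The indices 0, 1, 2 : 'I_3 are the paper's 1, 2, 3. *)
Definition pi_map (R : realType) (A : 'M[R[i]]_3) : 'rV[R[i]^o]_7 :=
  \row_(k < 7) [:: A 0 0;
                   A 1 1;
                   A 0 0 * A 1 1 - A 0 1 * A 1 0;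
                   A 2 2;
                   A 0 0 * A 2 2 - A 0 2 * A 2 0;
                   A 1 1 * A 2 2 - A 1 2 * A 2 1;
                   \det A]`_k.

Definition Gamma (R : realType) : set 'rV[R[i]^o]_7 :=
  [set pi_map A | A in [set A : 'M[R[i]]_3 | mu (E33111 R) A <= 1]].
Arguments Gamma R : clear implicits.

(* Main.v *)
(* Gamma is stable under the weighted dilations x |-> (r x1, r x2, r^2 x3,
   r x4, r^2 x5, r^2 x6, r^3 x7), 0 <= r <= 1: they lift to A |-> r A, and
   mu (r A) = r mu A for r > 0. Hence Gamma contracts to the origin. A loop f
   at x is then deformed, with its base point fixed, into "dilate x to r x,
   follow the dilated loop r f, come back": at r = 0 only the ray from x to 0
   and back remains, and this ray is retracted onto x. *)
Require Import Defs.
From mathcomp Require Import all_boot all_order all_algebra.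
From mathcomp Require Import all_classical all_reals all_analysis.
From mathcomp Require Import complex ring lra.
Import numFieldNormedType.Exports.
Import Order.TTheory GRing.Theory Num.Theory.

Set Implicit Arguments.
Unset Strict Implicit.
Unset Printing Implicit Defensive.

Local Open Scope classical_set_scope.
Local Open Scope ring_scope.
Local Open Scope complex_scope.

(** * Homogeneity of the structured singular value under positive real scaling *)

Section Scaling.
Variable R : realType.
Implicit Types (S : set R) (r : R).

Lemma le_sup_scale S r : 0 < r -> has_sup S ->
  sup [set r * x | x in S] <= r * sup S.
Proof.
move=> r0 [[x Sx] uS]; apply: ge_sup; first by exists (r * x), x.
by move=> _ [y Sy <-]; rewrite ler_pM2l//; exact: ub_le_sup.
Qed.

Lemma has_sup_scale S r : 0 < r -> has_sup S -> has_sup [set r * x | x in S].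
Proof.
move=> r0 [[x Sx] [u uS]]; split; first by exists (r * x), x.
by exists (r * u) => _ [y Sy <-]; rewrite ler_pM2l//; exact: uS.
Qed.

Lemma scaleK_set S r : 0 < r ->
  [set r^-1 * x | x in [set r * x | x in S]] = S.
Proof.
move=> r0; apply/seteqP; split => [_ [_ [x Sx <-] <-]|x Sx].
  by rewrite mulKf// gt_eqF.
by exists (r * x); [exists x|rewrite mulKf// gt_eqF].
Qed.

Lemma sup_scale S r : 0 < r -> sup [set r * x | x in S] = r * sup S.
Proof.
move=> r0; have ri0 : 0 < r^-1 by rewrite invr_gt0.
(* If [has_sup S] fails, it also fails for the scaled set, since scaling by [r^-1] recovers [S];
   both sides are then the default value 0. Otherwise the converse inequality is [le_sup_scale] for
   [r^-1] and the scaled set. *)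
have [hS|nS] := pselect (has_sup S); last first.
  rewrite !sup_out ?mulr0// => /(has_sup_scale ri0).
  by rewrite scaleK_set.
apply/eqP; rewrite eq_le le_sup_scale//= -ler_pdivlMl//.
by rewrite -[in leLHS](scaleK_set S r0) le_sup_scale//; exact: has_sup_scale.
Qed.

Lemma inf_scale S r : 0 < r -> inf [set r * x | x in S] = r * inf S.
Proof.
move=> r0; rewrite /inf mulrN -sup_scale//; congr (- sup _).
by rewrite !image_comp; congr (_ @` _); apply/funext => x /=; rewrite mulrN.
Qed.

Lemma enormZ n r (v : 'cV[R[i]]_n) : 0 <= r ->
  enorm (r%:C *: v) = r * enorm v.
Proof.
move=> r0; rewrite /enorm.
under eq_bigr => k _.
  rewrite mxE ComplexField.Normc.normcM exprMn.
  rewrite [ComplexField.Normc.normc _]/= expr0n/= addr0 sqrtr_sqr ger0_norm//.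
  over.
by rewrite -mulr_sumr sqrtrM ?sqr_ge0// sqrtr_sqr ger0_norm.
Qed.

Lemma opnormZ n r (X : 'M[R[i]]_n) : 0 < r ->
  opnorm (r%:C *: X) = r * opnorm X.
Proof.
move=> r0; rewrite /opnorm -sup_scale// image_comp; congr (sup (_ @` _)).
by apply/funext => v /=; rewrite -scalemxAl enormZ// ltW.
Qed.

Lemma singularizingZ n (E : {vspace 'M[R[i]]_n}) (A : 'M[R[i]]_n) r : 0 < r ->
  singularizing E (r%:C *: A) = [set r^-1%:C *: X | X in singularizing E A].
Proof.
move=> r0.
have E1 : r%:C * r^-1%:C = 1 :> R[i] by rewrite -rmorphM/= divff// gt_eqF.
apply/seteqP; split => [X [XE dX]|_ [X [XE dX] <-]].
  exists (r%:C *: X); last by rewrite scalerA mulrC E1 scale1r.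
  by split; [exact: memvZ|rewrite -scalemxAr scalemxAl].
split; first exact: memvZ.
by rewrite -scalemxAr -scalemxAl scalerA mulrC E1 scale1r.
Qed.

(** Replacing [A] by [r A] divides each singularizing [X] by [r], so the infimum of the norms is
    divided by [r] and its inverse multiplied by [r]. *)
Lemma muZ n (E : {vspace 'M[R[i]]_n}) (A : 'M[R[i]]_n) r : 0 < r ->
  mu E (r%:C *: A) = r * mu E A.
Proof.
move=> r0; rewrite /mu singularizingZ//.
have -> : ([set r^-1%:C *: X | X in singularizing E A] = set0) =
    (singularizing E A = set0).
  by apply/propext; split=> [/image_set0_set0 //|->]; exact: image_set0.
case: ifPn => _; first by rewrite mulr0.
have -> : [set opnorm X | X in [set r^-1%:C *: X | X in singularizing E A]] =
    [set r^-1 * x | x in [set opnorm X | X in singularizing E A]].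
  rewrite !image_comp; congr (_ @` _); apply/funext => X /=.
  by rewrite opnormZ// invr_gt0.
by rewrite inf_scale ?invr_gt0// invfM invrK mulrCA.
Qed.

Lemma mu0 n (E : {vspace 'M[R[i]]_n}) : mu E (0 : 'M[R[i]]_n) = 0.
Proof.
rewrite /mu; case: asboolP => // -[].
rewrite -subset0 => X [_]; rewrite mul0mx subr0 det1 => /eqP.
by rewrite oner_eq0.
Qed.

Lemma le1_muZ n (E : {vspace 'M[R[i]]_n}) (A : 'M[R[i]]_n) r : 0 <= r <= 1 ->
  mu E A <= 1 -> mu E (r%:C *: A) <= 1.
Proof.
case/andP; rewrite le_eqVlt => /predU1P[<- _ _|r0 r1 mA].
  by rewrite scale0r mu0.
(* The sign of [mu E A] has not been established; a negative value would stay nonpositive after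
   scaling. *)
rewrite muZ//; have [m0|m0] := leP 0 (mu E A).
  exact: mulr_ile1 (ltW r0) m0 r1 mA.
by apply: le_trans ler01; rewrite mulr_ge0_le0 ?(ltW r0) ?(ltW m0).
Qed.

End Scaling.

(** * Continuity of matrix-valued maps, minima, maxima and powers *)

Lemma continuous_mx (S T : topologicalType) m n (f : S -> 'M[T]_(m, n)) :
  (forall i j, continuous (fun x => f x i j)) -> continuous f.
Proof.
move=> fC x A [P nP PA].
have: \forall y \near x, forall i j, P i j (f y i j).
  by apply: filter_forall => i; apply: filter_forall => j; apply: fC.
by apply: filterS => y Py; exact: PA.
Qed.

Lemma continuous_minr (R : realType) (S : topologicalType) (f g : S -> R) :
  continuous f -> continuous g -> continuous (fun s => Num.min (f s) (g s)).
Proof. move=> fC gC s; exact: continuous_min (fC s) (gC s). Qed.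

Lemma continuous_maxr (R : realType) (S : topologicalType) (f g : S -> R) :
  continuous f -> continuous g -> continuous (fun s => Num.max (f s) (g s)).
Proof. move=> fC gC s; exact: continuous_max (fC s) (gC s). Qed.

Lemma continuous_exprn (K : numFieldType) n :
  continuous (fun x : K^o => x ^+ n).
Proof.
move=> x; elim: n => [|n /(continuousM cvg_id) IHn].
  exact: cst_continuous.
by rewrite /continuous_at exprS; under eq_fun do rewrite exprS; exact: IHn.
Qed.

(** * Simple connectedness of sets stable under a contraction to 0 *)

Section Contraction.
Variables (R : realType) (K : numFieldType) (V : normedModType K).

(** Retracts the line onto [[0, 1]]. Precomposition with it turns a path that is continuous only on
    the interval into a globally continuous map, and piecewise motions become single formulas. *)
Definition clamp (t : R) : R := Num.max 0 (Num.min t 1).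

Lemma clampP t : 0 <= clamp t <= 1.
Proof. by rewrite /clamp le_max lexx/= ge_max ler01 ge_min lexx orbT. Qed.

Lemma clamp_id t : 0 <= t <= 1 -> clamp t = t.
Proof. by case/andP=> t0 t1; rewrite /clamp (min_idPl t1) (max_idPr t0). Qed.

Lemma clamp_le0 t : t <= 0 -> clamp t = 0.
Proof. by move=> t0; apply/max_idPl; rewrite ge_min t0. Qed.

Lemma clamp_ge1 t : 1 <= t -> clamp t = 1.
Proof. by move=> t1; rewrite /clamp (min_idPr t1) (max_idPr ler01). Qed.

Lemma continuous_clamp : continuous clamp.
Proof.
apply: continuous_maxr; first by move=> t; exact: cvg_cst.
by apply: continuous_minr; move=> t; [exact: cvg_id|exact: cvg_cst].
Qed.

Lemma continuous_clamp_fun (S : topologicalType) (f : S -> R) :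
  continuous f -> continuous (fun s => clamp (f s)).
Proof.
by move=> fC s; apply: continuous_comp (fC s) _; exact: continuous_clamp.
Qed.

Lemma continuous_comp_clamp (T : topologicalType) (f : R -> T) :
  {within `[0, 1], continuous f} -> continuous (f \o clamp).
Proof.
move=> /subspace_continuousP fC t.
have ct s : `[0, 1]%classic (clamp s) by rewrite /= in_itv/= clampP.
apply: cvg_comp (fC _ (ct t)) => B /continuous_clamp.
by apply: (@filterS _ (nbhs t)) => s; exact: (@^~ (ct s)).
Qed.

Variable d : R -> V -> V.
Hypothesis dC : continuous (fun p : R * V => d p.1 p.2).

Lemma continuous_action (S : topologicalType) (a : S -> R) (b : S -> V) :
  continuous a -> continuous b -> continuous (fun s => d (a s) (b s)).
Proof.
move=> aC bC s.
by apply: continuous2_cvg; [exact: (@dC (a s, b s))|exact: aC|exact: bC].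
Qed.

Hypotheses (d1 : forall x, d 1 x = x) (d0 : forall x, d 0 x = 0).
Variable A : set V.
Hypotheses (dA : forall r x, 0 <= r <= 1 -> A x -> A (d r x)) (A0 : A !=set0).

Lemma contraction_path_connected : path_connected R A.
Proof.
split=> // x y Ax Ay.
(* Contract [x] to 0 during the first half, then expand from 0 to [y]. At every time one of the two
   summands is 0, so the sum stays in [A]. *)
exists (fun t => d (clamp (1 - 2 * t)) x + d (clamp (2 * t - 1)) y); split.
- have xC z : continuous (fun _ : R => z : V) by move=> t; exact: cvg_cst.
  have upC : continuous (fun t : R => clamp (2 * t - 1)).
    apply: continuous_clamp_fun => t.
    by apply: cvgB; [apply: cvgMr; exact: cvg_id|exact: cvg_cst].
  have downC : continuous (fun t : R => clamp (1 - 2 * t)).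
    apply: continuous_clamp_fun => t.
    by apply: cvgB; [exact: cvg_cst|apply: cvgMr; exact: cvg_id].
  apply: continuous_subspaceT => t.
  apply: cvgD; first exact: (continuous_action downC (xC x)).
  exact: (continuous_action upC (xC y)).
- move=> _ [t _ <-]; have [t2|t2] := leP (2 * t) 1.
    rewrite (@clamp_le0 (2 * t - 1)) ?d0 ?addr0 ?subr_le0//.
    exact/dA/Ax/clampP.
  rewrite (@clamp_le0 (1 - 2 * t)) ?d0 ?add0r ?subr_le0 ?ltW//.
  exact/dA/Ay/clampP.
- by rewrite mulr0 subr0 sub0r clamp_ge1// clamp_le0 ?lerN10// d1 d0 addr0.
- by rewrite mulr1 clamp_le0 ?clamp_ge1 ?d1 ?d0 ?add0r//; lra.
Qed.

(* Depth profile: [d (depth u t) x] runs from [x] down to [d u x] for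
   [t <= 1/3], and back up to [x] for [t >= 2/3]. *)
Definition depth (u t : R) : R :=
  clamp (Num.max u (Num.max (1 - 3 * t) (3 * t - 2))).

Lemma depth_eq1 u t : [|| 1 <= u, t <= 0 | 1 <= t] -> depth u t = 1.
Proof. by move=> h; apply: clamp_ge1; rewrite !le_max; lra. Qed.

Lemma continuous_depth (S : topologicalType) (u t : S -> R) :
  continuous u -> continuous t -> continuous (fun s => depth (u s) (t s)).
Proof.
move=> uC tC; apply: continuous_clamp_fun.
apply: continuous_maxr => //; apply: continuous_maxr => s; apply: cvgB;
  by [exact: cvg_cst|apply: cvgMr; exact: tC].
Qed.

Lemma contraction_loop_null_homotopic x (f : R -> V) :
  A x -> is_path A x x f -> null_homotopic A x f.
Proof.
move=> Ax [fC fA f0 f1].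
(* The two summands in parentheses cancel while [s2 = 0]; once [s1 = 1] the
   first and the last ones do. So [H] follows one stage after the other, and
   its continuity needs no gluing. *)
pose s1 (p : R * R) : R := clamp (2 * p.1).
pose s2 (p : R * R) : R := clamp (2 * p.1 - 1).
(* As [s1] grows from 0 to 1, the argument of [f] passes from [t] to [3 t - 1]: the loop is squeezed
   into the middle third, and [f] rests at [x] while the depth descends or climbs back. *)
pose H (p : R * R) : V :=
  d (depth (1 - s1 p) p.2) (f (clamp ((1 + 2 * s1 p) * p.2 - s1 p))) +
  (d (depth (s2 p) p.2) x - d (depth 0 p.2) x).
have fst_cont : continuous (fst : R * R -> R) by move=> p; exact: cvg_fst.
have snd_cont : continuous (snd : R * R -> R) by move=> p; exact: cvg_snd.
have s1C : continuous s1.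
  by apply: continuous_clamp_fun => p; apply: cvgMr; exact: fst_cont.
have s2C : continuous s2.
  apply: continuous_clamp_fun => p.
  by apply: cvgB; [apply: cvgMr; exact: fst_cont|exact: cvg_cst].
have xC : continuous (fun _ : R * R => x) by move=> p; exact: cvg_cst.
have cC c : continuous (fun _ : R * R => c : R) by move=> p; exact: cvg_cst.
have HC : continuous H.
  move=> p; apply: cvgD; last apply: cvgB.
  - apply: (@continuous_action _ (fun p => depth (1 - s1 p) p.2)
      (fun p => f (clamp ((1 + 2 * s1 p) * p.2 - s1 p)))).
      apply: continuous_depth => // {}p.
      by apply: cvgB; [exact: cC|exact: s1C].
    move=> {}p; apply: (@continuous_comp _ _ _
      (fun p => (1 + 2 * s1 p) * p.2 - s1 p) (f \o clamp)).
      apply: cvgB; last exact: s1C.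
      apply: cvgM; last exact: snd_cont.
      by apply: cvgD; [exact: cC|apply: cvgMr; exact: s1C].
    exact: continuous_comp_clamp.
  - exact: (continuous_action (continuous_depth s2C snd_cont) xC).
  - exact: (continuous_action (continuous_depth (cC 0) snd_cont) xC).
have H_early s t : 2 * s <= 1 -> H (s, t) =
    d (depth (1 - s1 (s, t)) t)
      (f (clamp ((1 + 2 * s1 (s, t)) * t - s1 (s, t)))).
  move=> s_le; rewrite /H/= /s2/= (@clamp_le0 (2 * s - 1)) ?subr_le0//.
  by rewrite subrr addr0.
have H_late s t : 1 <= 2 * s -> H (s, t) = d (depth (s2 (s, t)) t) x.
  move=> s_ge; rewrite /H/= /s1/= clamp_ge1// subrr.
  (* On the outer thirds the clamped argument is 0 or 1, where [f] is [x]; on the middle third the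
     depth is 0 and [d 0] forgets the point. *)
  suff -> : d (depth 0 t) (f (clamp ((1 + 2 * 1) * t - 1))) = d (depth 0 t) x.
    by rewrite addrC subrK.
  have [t_le|t_gt] := leP (3 * t) 1; first by rewrite clamp_le0 ?f0//; lra.
  have [t_ge|t_lt] := leP 2 (3 * t); first by rewrite clamp_ge1 ?f1//; lra.
  by rewrite /depth clamp_le0 ?d0// !ge_max; lra.
exists H; split.
- exact: continuous_subspaceT.
(* In each half the sum reduces to a single [d r z] with [r] in [[0, 1]] and [z] in [A]. *)
- move=> _ [[s t] _ <-]; have [s_le|s_gt] := leP (2 * s) 1.
    rewrite H_early//; apply: dA; first exact: clampP.
    by apply: fA; exists (clamp ((1 + 2 * s1 (s, t)) * t - s1 (s, t)));
      rewrite //= in_itv/= clampP.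
  by rewrite H_late 1?ltW//; apply: dA => //; exact: clampP.
- move=> t; rewrite in_itv/= => t01.
  rewrite H_early ?mulr0// /s1/= mulr0 clamp_le0// mulr0 !subr0 addr0 mul1r.
  by rewrite clamp_id// depth_eq1 ?lexx.
- move=> t _; rewrite H_late; last by lra.
  by rewrite depth_eq1// /s2/= clamp_ge1; lra.
(* At both ends of the loop every depth is 1, and the argument of [f] before clamping is
   [- s1 <= 0], respectively [1 + s1 >= 1]. *)
- move=> s _; split.
    rewrite /H/= !depth_eq1 ?lexx ?orbT// mulr0 sub0r clamp_le0 ?oppr_le0.
      by rewrite f0 d1 subrr addr0.
    by have /andP[] := clampP (2 * s).
  rewrite /H/= !depth_eq1 ?lexx ?orbT// mulr1 clamp_ge1.
    by rewrite f1 d1 subrr addr0.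
  have /andP[] := clampP (2 * s); rewrite -/(s1 (s, 1)); lra.
Qed.

Lemma contraction_simply_connected : simply_connected R A.
Proof.
split; first exact: contraction_path_connected.
exact: contraction_loop_null_homotopic.
Qed.

End Contraction.

(** * The weighted dilations and their action on [Gamma] *)

Section Dilation.
Variable R : realType.

(** Each coordinate of [pi_map] is a principal minor; its weight is the size of that minor, hence
    its degree in the entries of the matrix. *)
Definition dilation_weight (k : 'I_7) : nat :=
  (nth 0 [:: 1; 1; 2; 1; 2; 2; 3] k)%N.

Definition dilation (r : R) (x : 'rV[R[i]^o]_7) : 'rV[R[i]^o]_7 :=
  \row_k (r%:C ^+ dilation_weight k * x 0 k).

Lemma pi_mapZ r (A : 'M[R[i]]_3) :
  pi_map (r%:C *: A) = dilation r (pi_map A).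
Proof.
apply/rowP => k; rewrite !mxE detZ.
by case: k => -[|[|[|[|[|[|[|k]]]]]]] k_lt7 //;
  rewrite /dilation_weight/=; ring.
Qed.

Lemma dilation1 x : dilation 1 x = x.
Proof. by apply/rowP => k; rewrite mxE expr1n mul1r. Qed.

(** All weights are positive, so every power of 0 that occurs vanishes. *)
Lemma dilation0 x : dilation 0 x = 0.
Proof.
apply/rowP => k; rewrite !mxE.
by case: k => -[|[|[|[|[|[|[|k]]]]]]] //= ?; rewrite expr0n/= mul0r.
Qed.

Lemma dilation_Gamma r x : 0 <= r <= 1 -> Gamma R x -> Gamma R (dilation r x).
Proof.
move=> r01 [A mA <-]; exists (r%:C *: A); last by rewrite pi_mapZ.
exact: le1_muZ.
Qed.

Lemma Gamma0 : Gamma R !=set0.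
Proof. by exists (pi_map 0), 0; rewrite //= mu0. Qed.

Lemma continuous_real_complex : continuous (fun r : R => r%:C : R[i]^o).
Proof.
(* In the order on complex numbers, [0 < e] forces the imaginary part of [e] to vanish, so the
   estimate becomes one between reals. *)
move=> r; apply/cvgrPdist_lt => e; rewrite ltcE/= => /andP[/eqP ei e0].
near=> s.
rewrite -rmorphB /= ltcE /= ei eqxx /= expr0n/= addr0 sqrtr_sqr.
by near: s; apply: cvgr_dist_lt.
Unshelve. all: by end_near. Qed.

Lemma continuous_dilation :
  continuous (fun p : R * 'rV[R[i]^o]_7 => dilation p.1 p.2).
Proof.
apply: continuous_mx => i k.
have -> : (fun p : R * 'rV[R[i]^o]_7 => dilation p.1 p.2 i k) =
    (fun p => p.1%:C ^+ dilation_weight k * p.2 0 k).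
  by apply/funext => p; rewrite mxE.
move=> p.
apply: (@cvgM _ _ _ _ (fun q : R * 'rV[R[i]^o]_7 => q.1%:C ^+ dilation_weight k)
  (fun q : R * 'rV[R[i]^o]_7 => q.2 0 k)).
  apply: (@continuous_comp _ _ _ (fun q : R * 'rV[R[i]^o]_7 => q.1%:C : R[i]^o)
    (fun z : R[i]^o => z ^+ dilation_weight k)); last exact: continuous_exprn.
  apply: (@continuous_comp _ _ _ fst); first exact: cvg_fst.
  exact: continuous_real_complex.
apply: (@continuous_comp _ _ _ snd (fun x : 'rV[R[i]^o]_7 => x 0 k)).
  exact: cvg_snd.
exact: coord_continuous.
Qed.

End Dilation.

Theorem corollary3p2 (R : realType) : simply_connected R (Gamma R).
Proof.
apply: (contraction_simply_connected (@continuous_dilation R)).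
- exact: dilation1.
- exact: dilation0.
- exact: dilation_Gamma.
- exact: Gamma0.
Qed.
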